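(* Let $n\ge 1$ be an integer and let $A=(a_{ij})$ be an $n\times n$ totally nonnegative matrix. Then the following inequalities hold. (1) Let $A^*=(a^*_{ik}):=A\circ(\operatorname{adj}A)^T-(\det A)\,I_n$, where $\circ$ is the entrywise product. For every $i\in\{1,\dots,n\}$, $$(-1)^{i+l}\sum_{k=1}^{l}a_{ik}^*\ \ge\ 0\qquad\text{for all } l\in\{1,\dots,n\}.$$ (2) For all $i,j\in\{1,\dots,n\}$ with $i\neq j$, $$(-1)^{j+l}\sum_{k=1}^{l}(-1)^{j+k}a_{ik}\det A_{jk}\ \ge\ 0\qquad\text{for all } l\in\{1,\dots,n\},$$ where $A_{jk}$ is the submatrix of $A$ obtained by omitting the $j$-th row and the $k$-th column.
   Context: A real matrix is totally nonnegative (TN) if the determinant of each of its square submatrices is $\ge 0$. $\operatorname{adj}A$ is the adjugate of $A$, so the $(i,k)$ entry of $(\operatorname{adj}A)^T$ is $(-1)^{i+k}\det A_{ik}$, where $A_{ik}$ is $A$ with row $i$ and column $k$ omitted (the determinant of the empty matrix is $1$). $I_n$ is the $n\times n$ identity matrix. *)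

(* Defs.v *)
From mathcomp Require Import all_boot all_order all_algebra.
From mathcomp Require Import reals.

Set Implicit Arguments.
Unset Strict Implicit.
Unset Printing Implicit Defensive.

Import Order.TTheory GRing.Theory Num.Theory.
Local Open Scope ring_scope.

(* A square submatrix is selected by strictly increasing maps f (rows) and
   g (columns). *)
Definition totally_nonneg (R : realType) (m n : nat) (A : 'M[R]_(m, n)) : Prop :=
  forall (p : nat) (f : 'I_p -> 'I_m) (g : 'I_p -> 'I_n),
    {homo f : x y / (x < y)%N} -> {homo g : x y / (x < y)%N} ->
    0 <= \det (mxsub f g A).

(* A o (adj A)^T - (det A) I_n, where map2_mx *%R is the entrywise product. *)
Definition star_mx (R : realType) (n : nat) (A : 'M[R]_n) : 'M[R]_n :=
  map2_mx *%R A (\adj A)^T - \det A *: 1%:M.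

(* Main.v *)
(* Write [T_l(A, i) = sum_(k <= l) (-1)^(k+l) a_{ik} det A_{ik}].  For l < i it is
   nonnegative by induction on n: if S is the Schur complement of [a_{00} > 0] and
   B is the matrix obtained from S by deleting the row that comes from row i of A
   and putting [(a_{01}, ..., a_{0,n-1})] on top, then S and B are totally
   nonnegative and
     T_l(A, i) = a_{00} T_{l-1}(S, i-1) + a_{i0} T'_{l-1}(B, 0),
   where T' is the analogous sum over k > l, which is a sum T for the matrix with
   rows and columns reversed; if [a_{00} = 0], the first row or column of A
   vanishes.  Since the full sum is [+- det A], the bounds on T (l < i) and T'
   (l >= i) give (1).  Statement (2) is (1) for the matrix obtained from A by
   deleting row j and duplicating row i. *)
Require Import Defs.
From mathcomp Require Import all_boot all_order all_algebra.
From mathcomp Require Import reals.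
From mathcomp Require Import perm zify ring.
Import Order.TTheory GRing.Theory Num.Theory.
Local Open Scope ring_scope.

Set Implicit Arguments.
Unset Strict Implicit.
Unset Printing Implicit Defensive.

(** * Signs, index maps and determinants under reindexing or elimination *)

Lemma eq_signr (R : pzRingType) (m n : nat) :
  odd m = odd n -> (-1) ^+ m = (-1) ^+ n :> R.
Proof. by move=> mn; rewrite -signr_odd mn signr_odd. Qed.

Lemma row'_col'E (T : Type) (n : nat) (i j : 'I_n) (A : 'M[T]_n) :
  row' i (col' j A) = mxsub (lift i) (lift j) A.
Proof. by apply/matrixP => x y; rewrite !mxE. Qed.

Lemma ltn_lift (n : nat) (i : 'I_n) : {homo lift i : x y / (x < y)%N}.
Proof. by move=> x y /=; rewrite /bump; lia. Qed.

Lemma lift_lift0 (n : nat) (i : 'I_n.+1) : lift (lift 0 i) 0 = 0.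
Proof. exact/val_inj. Qed.

Lemma lift_liftS (n : nat) (i : 'I_n.+1) (x : 'I_n) :
  lift (lift 0 i) (lift 0 x) = lift 0 (lift i x).
Proof. by apply/val_inj; rewrite /= bumpS. Qed.

Lemma det_mxsub_perm (F : comUnitRingType) (n : nat) (s : 'S_n) (M : 'M[F]_n) :
  \det (mxsub s s M) = \det M.
Proof.
have -> : mxsub s s M = row_perm s (col_perm s M).
  by apply/matrixP => x y; rewrite !mxE.
rewrite row_permE col_permE !det_mulmx !det_perm odd_permV.
by rewrite mulrCA -expr2 sqrr_sign mulr1.
Qed.

Lemma det_mxsub_rev (F : comUnitRingType) (n : nat) (M : 'M[F]_n) :
  \det (mxsub (@rev_ord n) (@rev_ord n) M) = \det M.
Proof.
rewrite -[RHS](det_mxsub_perm (perm (@rev_ord_inj n))); congr (\det _).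
by apply/matrixP => x y; rewrite !mxE !permE.
Qed.

(** [N = L *m M] with [L] unit lower triangular. *)
Lemma det_addl_row0 (F : comUnitRingType) (n : nat) (c : 'cV[F]_n)
    (M N : 'M[F]_n.+1) :
  (forall y, N 0 y = M 0 y) ->
  (forall x y, N (lift 0 x) y = M (lift 0 x) y - c x 0 * M 0 y) ->
  \det N = \det M.
Proof.
move=> N0 NS.
pose L : 'M[F]_n.+1 := \matrix_(x, y)
  ((x == y)%:R - (if unlift 0 x is Some x' then c x' 0 else 0) * (y == 0)%:R).
have -> : N = L *m M.
  apply/matrixP => x y; rewrite mxE.
  under eq_bigr => k _ do rewrite mxE mulrBl.
  rewrite sumrB (bigD1 x) //= eqxx mul1r big1 => [|k]; last first.
    by rewrite eq_sym => /negbTE ->; rewrite mul0r.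
  rewrite (bigD1 0) //= mulr1 big1 => [|k /negbTE ->]; last first.
    by rewrite mulr0 mul0r.
  rewrite !addr0; have [x' ->|->] := unliftP 0 x; first exact: NS.
  by rewrite mul0r subr0 N0.
rewrite det_mulmx det_trig ?big1 ?mul1r // => [x _|].
  rewrite mxE eqxx; have [x' ->|->] := unliftP 0 x.
    by rewrite eq_sym (negbTE (neq_lift _ _)) mulr0 subr0.
  by rewrite mul0r subr0.
apply/is_trig_mxP => x y xy; rewrite mxE.
have -> : (x == y) = false by apply/eqP => exy; rewrite exy ltnn in xy.
have -> : (y == 0) = false by apply/eqP => y0; rewrite y0 in xy.
by rewrite mulr0 subr0.
Qed.

(** * Schur complement of the top left entry *)

Definition schur (F : fieldType) (m n : nat) (A : 'M[F]_(m.+1, n.+1)) :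
    'M[F]_(m, n) :=
  \matrix_(x, y) (A (lift 0 x) (lift 0 y)
                  - A (lift 0 x) 0 / A 0 0 * A 0 (lift 0 y)).

Lemma det_schur (F : fieldType) (n : nat) (A : 'M[F]_n.+1) :
  A 0 0 != 0 -> \det A = A 0 0 * \det (schur A).
Proof.
move=> A00.
pose N : 'M[F]_n.+1 := \matrix_(x, y)
  if unlift 0 x is Some x' then A x y - A x 0 / A 0 0 * A 0 y else A x y.
rewrite -(@det_addl_row0 _ _ (\col_x (A (lift 0 x) 0 / A 0 0)) A N); first last.
- by move=> x y; rewrite !mxE liftK.
- by move=> y; rewrite mxE unlift_none.
rewrite (expand_det_col _ 0) big_ord_recl big1 => [|x _]; last first.
  by rewrite mxE liftK divfK // subrr mul0r.
rewrite addr0 mxE unlift_none /cofactor addn0 expr0 mul1r; congr (_ * \det _).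
by apply/matrixP => x y; rewrite !mxE liftK.
Qed.

(** Adds the pivot index 0 to a selection of rows or columns of [schur A]. *)
Definition lift_fun0 (p n : nat) (f : 'I_p -> 'I_n) (x : 'I_p.+1) : 'I_n.+1 :=
  if unlift 0 x is Some x' then lift 0 (f x') else 0.

Lemma lift_fun00 (p n : nat) (f : 'I_p -> 'I_n) : lift_fun0 f 0 = 0.
Proof. by rewrite /lift_fun0 unlift_none. Qed.

Lemma lift_fun0S (p n : nat) (f : 'I_p -> 'I_n) x :
  lift_fun0 f (lift 0 x) = lift 0 (f x).
Proof. by rewrite /lift_fun0 liftK. Qed.

Lemma ltn_lift_fun0 (p n : nat) (f : 'I_p -> 'I_n) :
  {homo f : x y / (x < y)%N} -> {homo lift_fun0 f : x y / (x < y)%N}.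
Proof.
move=> f_mono x y.
have [x' ->|->] := unliftP 0 x; have [y' ->|->] := unliftP 0 y;
  rewrite ?lift_fun00 ?lift_fun0S //=.
exact: f_mono.
Qed.

(** * Consequences and stability of total nonnegativity *)

Section TotallyNonneg.
Variable R : realType.

(** By [det_schur], a minor of [A] through row and column 0 is [A 0 0] times the corresponding minor
    of [schur A]. *)
Lemma totally_nonneg_schur (m n : nat) (A : 'M[R]_(m.+1, n.+1)) :
  totally_nonneg A -> 0 < A 0 0 -> totally_nonneg (schur A).
Proof.
move=> hA A00 p f g fm gm.
have := hA _ _ _ (ltn_lift_fun0 fm) (ltn_lift_fun0 gm).
rewrite det_schur ?mxE !lift_fun00; last by rewrite gt_eqF.
rewrite pmulr_rge0 //; congr (0 <= \det _).
by apply/matrixP => x y; rewrite !mxE !lift_fun00 !lift_fun0S.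
Qed.

Lemma totally_nonneg_entry (m n : nat) (A : 'M[R]_(m, n)) i j :
  totally_nonneg A -> 0 <= A i j.
Proof.
move=> /(_ 1 (fun=> i) (fun=> j)); rewrite det_mx11 mxE.
by apply=> x y; rewrite !ord1.
Qed.

Lemma totally_nonneg_det_minor (n : nat) (A : 'M[R]_n) i j :
  totally_nonneg A -> 0 <= \det (row' i (col' j A)).
Proof. by rewrite row'_col'E => hA; apply: hA; apply: ltn_lift. Qed.

Lemma totally_nonneg_rev (m n : nat) (A : 'M[R]_(m, n)) :
  totally_nonneg A -> totally_nonneg (mxsub (@rev_ord m) (@rev_ord n) A).
Proof.
have rev_mono p q (f : 'I_p -> 'I_q) : {homo f : x y / (x < y)%N} ->
    {homo (fun x => rev_ord (f (rev_ord x))) : x y / (x < y)%N}.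
  move=> fm x y xy; have := fm (rev_ord y) (rev_ord x).
  have := ltn_ord x; have := ltn_ord y.
  have := ltn_ord (f (rev_ord x)); have := ltn_ord (f (rev_ord y)).
  move=> /=; lia.
move=> hA p f g fm gm.
have := hA p _ _ (rev_mono _ _ _ fm) (rev_mono _ _ _ gm).
rewrite -det_mxsub_rev -!mxsub_comp; congr (0 <= \det _).
by apply/matrixP => x y; rewrite !mxE /= !rev_ordK.
Qed.

Lemma det_minor_rev (n : nat) (A : 'M[R]_n) (i k : 'I_n) :
  \det (row' i (col' k (mxsub (@rev_ord n) (@rev_ord n) A))) =
  \det (row' (rev_ord i) (col' (rev_ord k) A)).
Proof.
have rev_lift (a : 'I_n) x : rev_ord (lift a x) = lift (rev_ord a) (rev_ord x).
  apply/val_inj; have := ltn_ord x; have := ltn_ord a; rewrite /= /bump; lia.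
rewrite !row'_col'E -[RHS]det_mxsub_rev; congr (\det _).
by apply/matrixP => x y; rewrite !mxE /= !rev_lift.
Qed.

(** If [A 0 y] is positive, the minor on rows 0, x and columns 0, y equals [- (A 0 y * A x 0)],
    which forces [A x 0 = 0]. *)
Lemma totally_nonneg_corner0 (m n : nat) (A : 'M[R]_(m.+1, n.+1)) :
  totally_nonneg A -> A 0 0 = 0 ->
  (forall y, A 0 y = 0) \/ (forall x, A x 0 = 0).
Proof.
move=> hA A00; case: (boolP [forall y, A 0 y == 0]) => [/forallP r0|].
  by left=> y; apply/eqP.
rewrite negb_forall => /existsP [y Ay]; right=> x.
have [x' ->|-> //] := unliftP 0 x.
have [y' ey|ey] := unliftP 0 y; last by rewrite ey A00 eqxx in Ay.
have fm k (z : 'I_k) : {homo (fun _ : 'I_1 => z) : s t / (s < t)%N}.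
  by move=> s t; rewrite !ord1.
have := hA _ _ _ (ltn_lift_fun0 (fm _ x')) (ltn_lift_fun0 (fm _ y')).
rewrite (expand_det_row _ 0) !big_ord_recl big_ord0 /cofactor !det_mx11 !mxE.
rewrite !(lift_fun00, lift_fun0S) -ey A00 mul0r add0r addr0.
rewrite (_ : lift (lift ord0 ord0) 0 = 0); last exact/val_inj.
rewrite lift_fun00 /= expr1 mulN1r mulrN oppr_ge0.
have a0 := totally_nonneg_entry (lift 0 x') 0 hA.
have b0 : 0 < A 0 y by rewrite lt_def Ay totally_nonneg_entry.
by rewrite pmulr_rle0 // => a0'; apply/le_anti; rewrite a0' a0.
Qed.

(** * Partial sums of the Laplace expansion along a row *)

Definition head_sum (n : nat) (A : 'M[R]_n) (i : 'I_n) (l : nat) : R :=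
  \sum_(k < n | (k <= l)%N) (-1) ^+ (k + l) * A i k * \det (row' i (col' k A)).

(** The extra sign makes this a [head_sum] of the reversed matrix; [head_sum A i l - tail_sum A i l]
    is [(-1) ^+ (i + l) * \det A]. *)
Definition tail_sum (n : nat) (A : 'M[R]_n) (i : 'I_n) (l : nat) : R :=
  \sum_(k < n | (l < k)%N)
    (-1) ^+ (k + l).+1 * A i k * \det (row' i (col' k A)).

Lemma tail_sum_rev (n : nat) (A : 'M[R]_n) (i : 'I_n) (l : nat) :
  (l.+1 < n)%N ->
  tail_sum A i l =
  head_sum (mxsub (@rev_ord n) (@rev_ord n) A) (rev_ord i) (n - l.+2).
Proof.
move=> ln; rewrite /tail_sum (reindex_inj rev_ord_inj) /=.
apply: eq_big => k.
  by have := ltn_ord k; lia.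
rewrite det_minor_rev !mxE !rev_ordK => lk; congr (_ * _ * _).
by apply: eq_signr; have := ltn_ord k; lia.
Qed.

Section SchurStep.
Variables (p : nat) (A : 'M[R]_p.+2) (i : 'I_p.+1).

Definition schur_border : 'M[R]_p.+1 := \matrix_(x, y)
  if unlift 0 x is Some x' then schur A (lift i x') y else A 0 (lift 0 y).

(** The lower rows of [schur_border] are rows of [A] without column 0, minus multiples of its top
    row. Since [f 0 = 0] selects that top row, the elimination can be undone inside the minor. *)
Lemma det_schur_border_minor q (f : 'I_q.+1 -> 'I_p.+1)
    (g : 'I_q.+1 -> 'I_p.+1) :
  f 0 = 0 -> {homo f : x y / (x < y)%N} ->
  \det (mxsub f g schur_border) =
  \det (mxsub (lift (lift 0 i) \o f) (lift 0 \o g) A).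
Proof.
move=> f0 fm.
apply: (@det_addl_row0 _ _
  (\col_x (A (lift (lift 0 i) (f (lift 0 x))) 0 / A 0 0))).
  by move=> y; rewrite !mxE /= f0 unlift_none lift_lift0.
move=> x y; rewrite !mxE /= f0 lift_lift0.
have := fm 0 (lift 0 x) isT; rewrite f0.
have [z ->|-> //] := unliftP 0 (f (lift 0 x)).
by rewrite mxE lift_liftS.
Qed.

Lemma det_schur_border : \det schur_border = \det (row' (lift 0 i) (col' 0 A)).
Proof.
by rewrite -[schur_border]mxsub_id det_schur_border_minor // row'_col'E.
Qed.

Lemma totally_nonneg_schur_border :
  totally_nonneg A -> 0 < A 0 0 -> totally_nonneg schur_border.
Proof.
move=> hA A00 [|q] f g fm gm; first by rewrite det_mx00.
have [z f0|f0] := unliftP 0 (f 0); last first.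
  rewrite det_schur_border_minor //; apply: hA => x y xy.
    exact: (@ltn_lift p.+2 _ _ _ (fm _ _ xy)).
  exact: (@ltn_lift p.+2 _ _ _ (gm _ _ xy)).
(* As [f] is increasing and [f 0] is not 0, the top row is not selected and the minor is one of
   [schur A]. *)
have [f' f'E] : exists f', forall x, f x = lift 0 (f' x).
  apply: (fin_all_exists (P := fun x y => f x = lift 0 y)) => x.
  have [y ->|fx] := unliftP 0 (f x); first by exists y.
  have [x' xE|xE] := unliftP 0 x; last by rewrite xE f0 in fx.
  by have := fm 0 (lift 0 x') isT; rewrite -xE fx.
have -> : mxsub f g schur_border = mxsub (lift i \o f') g (schur A).
  by apply/matrixP => x y; rewrite !mxE f'E liftK mxE.
apply: (totally_nonneg_schur hA A00) => // x y xy /=.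
by apply: ltn_lift; have := fm x y xy; rewrite !f'E /= /bump; lia.
Qed.

(* Writing [a_{ik} = s_{ik} + (a_{i0} / a_{00}) a_{0k}] leaves, after cancellation
   with [det A_{i0} = det schur_border] expanded along its first row, only the
   columns beyond l. *)
Lemma head_sum_schur (l : nat) : A 0 0 != 0 ->
  head_sum A (lift 0 i) l.+1 =
  A 0 0 * head_sum (schur A) i l + A (lift 0 i) 0 * tail_sum schur_border 0 l.
Proof.
move=> A00.
have minorS k : \det (row' (lift 0 i) (col' (lift 0 k) A)) =
    A 0 0 * \det (row' i (col' k (schur A))).
  rewrite (@det_schur _ p) mxE mxE !lift_lift0 //; congr (_ * \det _).
  by apply/matrixP => x y; rewrite !mxE !lift_lift0 !lift_liftS.
have minorB k : \det (row' 0 (col' k schur_border)) =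
    \det (row' i (col' k (schur A))).
  by congr (\det _); apply/matrixP => x y; rewrite !mxE liftK mxE.
have detB : \det schur_border = \sum_k
    A 0 (lift 0 k) * ((-1) ^+ k * \det (row' i (col' k (schur A)))).
  rewrite (expand_det_row _ 0); apply: eq_bigr => k _.
  by rewrite /cofactor minorB mxE unlift_none.
rewrite /head_sum /tail_sum big_mkcond big_ord_recl /=.
rewrite -det_schur_border detB.
rewrite [X in _ = _ * X + _]big_mkcond [X in _ = _ + _ * X]big_mkcond /=.
rewrite !mulr_sumr -!big_split /=; apply: eq_bigr => k _.
rewrite minorS minorB !mxE unlift_none /= /bump /= add0n add1n !addSn ltnS.
rewrite addnS !exprS exprD -[ord0]/(0 : 'I_p.+2).
by case: leqP => _; field.
Qed.

End SchurStep.

Lemma head_sum_ge0 (n : nat) (A : 'M[R]_n) (i : 'I_n) (l : nat) :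
  totally_nonneg A -> (l < i)%N -> 0 <= head_sum A i l.
Proof.
elim: n => [|n IHn] in A i l *; first by case: i.
case: l => [|l] hA li.
  apply: sumr_ge0 => k; rewrite leqn0 => /eqP ->.
  by rewrite mul1r mulr_ge0 ?totally_nonneg_entry ?totally_nonneg_det_minor.
case: n => [|p] in A i hA li IHn *; first by rewrite ord1 in li.
have [i' iE|iE] := unliftP 0 i; last by rewrite iE in li.
have {}li : (l < i')%N by rewrite iE in li.
rewrite iE; have [A00|A00] := eqVneq (A 0 0) 0.
  (* Every term vanishes: row 0 survives in each minor because i is positive, and column 0 survives
     unless k = 0, where the coefficient [A i 0] is itself in column 0. *)
  apply: sumr_ge0 => k _.
  have [r0|c0] := totally_nonneg_corner0 hA A00.
    rewrite (expand_det_row _ 0) big1 ?mulr0 // => y _.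
    by rewrite !mxE lift_lift0 r0 mul0r.
  have [k' ->|->] := unliftP 0 k; last by rewrite c0 mulr0 mul0r.
  rewrite (expand_det_col _ 0) big1 ?mulr0 // => x _.
  by rewrite !mxE lift_lift0 c0 mul0r.
have A00_gt0 : 0 < A 0 0 by rewrite lt_def A00 totally_nonneg_entry.
rewrite head_sum_schur //; apply: addr_ge0; apply: mulr_ge0.
- exact: ltW.
- by apply: IHn li; apply: totally_nonneg_schur.
- exact: totally_nonneg_entry.
have hB := totally_nonneg_schur_border i' hA A00_gt0.
have [lp|pl] := ltnP l.+1 p.+1.
  (* Reversal turns row 0 into the last row, of index p, and the new bound [p.+1 - l.+2] is below
     p. *)
  rewrite tail_sum_rev //; apply: IHn; first exact: totally_nonneg_rev.
  by rewrite /=; lia.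
rewrite /tail_sum big1 // => k; have := ltn_ord k; lia.
Qed.

Lemma tail_sum_ge0 (n : nat) (A : 'M[R]_n) (i : 'I_n) (l : nat) :
  totally_nonneg A -> (i <= l)%N -> 0 <= tail_sum A i l.
Proof.
move=> hA il; have [ln|nl] := ltnP l.+1 n.
  rewrite tail_sum_rev //; apply: head_sum_ge0; first exact: totally_nonneg_rev.
  by rewrite /=; lia.
rewrite /tail_sum big1 // => k; have := ltn_ord k; lia.
Qed.

(** For l < i the sum stops before the diagonal correction. Otherwise subtracting [\det A], the full
    expansion along row i, leaves minus the terms with k > l. *)
Lemma star_mx_sum_ge0 (n : nat) (A : 'M[R]_n) (i l : 'I_n) :
  totally_nonneg A ->
  0 <= (-1) ^+ (i + l) * \sum_(k < n | (k <= l)%N) star_mx A i k.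
Proof.
move=> hA; have starE k : star_mx A i k =
    (-1) ^+ (i + k) * A i k * \det (row' i (col' k A)) - \det A *+ (i == k).
  by rewrite !mxE /cofactor mulrCA mulrA mulr_natr.
have [li|il] := ltnP l i.
  rewrite (_ : _ * _ = head_sum A i l); first exact: head_sum_ge0.
  rewrite mulr_sumr; apply: eq_bigr => k kl; rewrite starE.
  have -> : (i == k) = false.
    by apply/eqP => ik; move: kl; rewrite -ik leqNgt li.
  rewrite subr0 !mulrA -exprD; congr (_ * _ * _).
  by apply: eq_signr; lia.
have detE :
    \sum_(k < n) (-1) ^+ (i + k) * A i k * \det (row' i (col' k A)) = \det A.
  rewrite (expand_det_row _ i); apply: eq_bigr => k _.
  by rewrite /cofactor mulrCA mulrA.
rewrite (_ : _ * _ = tail_sum A i l); first exact: tail_sum_ge0.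
under eq_bigr => k _ do rewrite starE.
rewrite sumrB [X in _ - X](bigD1 i) //= eqxx mulr1n.
rewrite [X in _ - (_ + X)]big1 ?addr0 => [|k /andP[_ /negbTE ki]]; last first.
  by rewrite eq_sym ki.
rewrite -detE [X in _ - X](bigID (fun k : 'I_n => (k <= l)%N)) /=.
rewrite opprD addrA subrr add0r.
rewrite mulrN mulr_sumr -sumrN /tail_sum.
apply: eq_big => k; rewrite -?ltnNge // => lk.
rewrite !mulrA -exprD -!mulNr -[X in X * _ * _]mulN1r -exprS.
by congr (_ * _ * _); apply: eq_signr; lia.
Qed.

End TotallyNonneg.

(** * Replacing row j by a second copy of row i *)

(* For p != i the value is lift j (unlift i p), so deleting the i-th index of
   the domain amounts to deleting j, while i is also hit by a second index. *)
Definition replace_fun (n : nat) (i j p : 'I_n) : 'I_n :=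
  if unlift i p is Some q then lift j q else i.

Lemma leq_replace_fun (n : nat) (i j : 'I_n) :
  {homo replace_fun i j : x y / (x <= y)%N}.
Proof.
move=> x y; rewrite /replace_fun.
have [x' ->|->] := unliftP i x; have [y' ->|->] := unliftP i y => //=;
  rewrite /bump; lia.
Qed.

(** If [h] merges two selected rows, the minor has equal rows and vanishes; otherwise [h \o f] is
    strictly increasing. *)
Lemma totally_nonneg_rowsub (R : realType) (m m' n : nat) (A : 'M[R]_(m, n))
    (h : 'I_m' -> 'I_m) :
  {homo h : x y / (x <= y)%N} -> totally_nonneg A ->
  totally_nonneg (rowsub h A).
Proof.
move=> hm hA p f g fm gm.
case: (boolP (injectiveb (h \o f))) => [/injectiveP hf_inj|].
  rewrite -mxsub_comp; apply: hA => // x y xy.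
  rewrite ltn_neqAle hm ?andbT; last exact/ltnW/fm.
  by apply/eqP => /val_inj /hf_inj exy; rewrite exy ltnn in xy.
move=> /injectivePn [x [y xy hxy]].
rewrite (determinant_alternate xy) // => z; rewrite !mxE.
by move: hxy => /= ->.
Qed.

(* Indices in 'I_n start at 0, so the sum over k = 1, ..., l is the sum over
   k <= l, and shifting both indices by 1 leaves (-1)^(i+l) unchanged. *)
Theorem theoremA (R : realType) (n : nat) (hn : (1 <= n)%N) (A : 'M[R]_n)
    (hA : totally_nonneg A) :
  (forall i l : 'I_n,
     0 <= (-1) ^+ (i + l) * \sum_(k < n | (k <= l)%N) star_mx A i k) /\
  (forall i j : 'I_n, i != j -> forall l : 'I_n,
     0 <= (-1) ^+ (j + l) *
          \sum_(k < n | (k <= l)%N)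
             (-1) ^+ (j + k) * A i k * \det (row' j (col' k A))).
Proof.
split=> [i l|i j ij l]; first exact: star_mx_sum_ge0.
pose A' := rowsub (replace_fun i j) A.
have hA' : totally_nonneg A'.
  exact: totally_nonneg_rowsub (@leq_replace_fun _ i j) hA.
have hi : replace_fun i j i = i by rewrite /replace_fun unlift_none.
have [i' iE|/eqP] := unliftP j i; last by rewrite (negbTE ij).
(* Rows i and [lift i i'] of [A'] are both row i of [A]. Hence the diagonal correction in
   [star_mx A'] is zero. *)
have detA' : \det A' = 0.
  apply: (determinant_alternate (neq_lift i i')) => k.
  by rewrite !mxE hi /replace_fun liftK -iE.
have minorA' k : row' i (col' k A') = row' j (col' k A).
  by apply/matrixP => x y; rewrite !mxE /replace_fun liftK.
have := star_mx_sum_ge0 i l hA'; congr (0 <= _).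
rewrite !mulr_sumr; apply: eq_bigr => k _.
rewrite !mxE detA' mul0r subr0 /cofactor minorA' hi.
rewrite [A i k * _]mulrCA !mulrA -!exprD.
by congr (_ * _ * _); apply: eq_signr; lia.
Qed.
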